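(* Consider the stochastic $N$-player Lipschitz continuous game and its randomized smoothed counterpart with parameter $\eta>0$. Suppose that each Clarke subdifferential $x_i\mapsto\partial^Ch_i(x_i)$ is $\hat L_i$-Lipschitz. Suppose that $x^R$, the output of the RS-RSG scheme, is a Clarke–Nash equilibrium of the smoothed game. Then $$\mathbb{E}\left[\mathrm{dist}(0,\mathbf{G}_{\gamma_R}(x^R))^2\right]\le2\eta^2\sum_{i=1}^N\hat L_i^2,$$ where $\mathbf{G}_{\gamma_R}(x^R)=\frac1{\gamma_R}(x^R-\Pi_X[x^R-\gamma_R\mathbf{F}(x^R)])$ is set-valued, with $\mathbf{F}(x^R)=(\partial^Ch_i(x_i^R))_{i=1}^N+(\nabla_{x_i}m_i(x_i^R,x_{-i}^R))_{i=1}^N$.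
   Context: Lipschitz continuous game. $[N]=\{1,\dots,N\}$; each $X_i\subseteq\mathbb{R}^{n_i}$ is nonempty, closed and convex; $X=\prod_iX_i$; $x_{-i}=(x_j)_{j\neq i}$. Given $x_{-i}$, player $i$ solves $\min_{x_i\in X_i}f_i(x_i,x_{-i})=h_i(x_i)+m_i(x_i,x_{-i})$, $h_i(x_i)=\mathbb{E}[\tilde h_i(x_i,\xi)]$, $m_i(x_i,x_{-i})=\mathbb{E}[\tilde m_i(x_i,x_{-i},\xi)]$, with $\xi$ a random vector, $\tilde h_i(\cdot,\xi)$ $L_i$-Lipschitz continuous for every $\xi$ over $X_i$ (and on the points at distance at most $\eta$ from $X_i$ used by the smoothing), and $\tilde m_i(\cdot,x_{-i},\xi)$ continuously differentiable. The game is assumed to admit a potential function $P$, i.e. $P(x_i^1,x_{-i})-P(x_i^2,x_{-i})=f_i(x_i^1,x_{-i})-f_i(x_i^2,x_{-i})$ for all $i$, $x_i^1,x_i^2\in X_i$, $x_{-i}$. Randomized smoothed game. $\mathbb{B}_{n_i}$ and $\mathbb{S}_{n_i}$ are the closed unit ball and unit sphere of $\mathbb{R}^{n_i}$. $h_i^\eta(x_i)=\mathbb{E}_{u_i}[h_i(x_i+\eta u_i)]$, $u_i$ uniform on $\mathbb{B}_{n_i}$; player $i$ solves $\min_{x_i\in X_i}f_i^\eta(x_i,x_{-i})=h_i^\eta(x_i)+m_i(x_i,x_{-i})$. A Clarke–Nash equilibrium of the smoothed game is $x^*\in X$ with $0\in\partial^C_{x_i}f_i^\eta(x_i^*,x_{-i}^*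 )+\mathcal{N}_{X_i}(x_i^* )$ for all $i$ (normal cone); since $f_i^\eta(\cdot,x_{-i})$ is $C^1$, this means $\nabla_{x_i}f_i^\eta(x^* )^\top(x_i-x_i^* )\ge0$ for all $x_i\in X_i$ and all $i$. Standing assumptions (Assumption C). The smoothed game admits a $C^1$ potential $P^\eta$ with $L^\eta$-Lipschitz gradient attaining its maximum and minimum over $X$; at every iterate $x^k$, $\nabla_{x_i}\tilde m_i(x^k,\xi)$ is conditionally unbiased for $\nabla_{x_i}m_i(x^k)$ with conditional second moment of the error at most $\sigma_m^2$. RS-RSG scheme. From $x^0\in X$, with stepsizes $\gamma_k>0$, batch sizes $S_k$, and $R$ random on $\{1,\dots,T\}$ with probability mass function $P_R$: for $k=0,\dots,R-1$ and each $i$, draw i.i.d. realizations $\xi_{i,l}^k$ of $\xi$ and $v_{i,l}^k$ uniform on $\eta\mathbb{S}_{n_i}$, $l=1,\dots,S_k$, and set $x_i^{k+1}=\Pi_{X_i}[x_i^k-\gamma_k\frac1{S_k}\sum_{l=1}^{S_k}(\Delta^{k,h}_{i,l}+\Delta^{k,m}_{i,l})]$ with $\Delta^{k,h}_{i,l}=\frac{n_i}{2\eta}(\tilde h_i(x_i^k+v_{i,l}^k,\xi_{i,l}^k)-\tilde h_i(x_i^k-v_{i,l}^k,\xi_{i,l}^k))\frac{v_{i,l}^k}{\|v_{i,l}^k\|}$, $\Delta^{k,m}_{i,l}=\nabla_{x_i}\tilde m_i(x_i^k,x_{-i}^k,\xi_{i,l}^k)$. The output is $x^R$. Notation. A set-valued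 map $\Phi:U\rightrightarrows\mathbb{R}^p$ is $\hat L$-Lipschitz on $U$ if $\Phi(x)\subseteq\Phi(y)+\hat L\|x-y\|\mathbb{B}$ for all $x,y\in U$ ($\mathbb{B}$ the closed unit ball); here it is applied to $\partial^Ch_i$ on $U=X_i+\eta\mathbb{B}_{n_i}$. $\mathrm{dist}(x,A)=\inf_{y\in A}\|y-x\|$; for a set $A$, $\Pi_X[A]=\{\Pi_X[a]:a\in A\}$, with $\Pi_X$ Euclidean projection. $\partial^C$ is the Clarke subdifferential. *)

(* Defs.v *)
From HB Require Import structures.
From mathcomp Require Import all_boot all_order all_algebra.
From mathcomp Require Import all_classical all_reals all_analysis.

Set Implicit Arguments.
Unset Strict Implicit.
Unset Printing Implicit Defensive.

Import Order.TTheory GRing.Theory Num.Theory.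
Import numFieldNormedType.Exports.

Local Open Scope classical_set_scope.
Local Open Scope ring_scope.

Definition dot (R : realType) n (u v : 'rV[R]_n) : R :=
  \sum_(j < n) u 0 j * v 0 j.

(* The library norm on ['rV[R]_n] is the sup norm, hence a separate name. *)
Definition enorm (R : realType) n (u : 'rV[R]_n) : R := Num.sqrt (dot u u).

Definition eball (R : realType) n : set 'rV[R]_n := [set u | enorm u <= 1].
Arguments eball : clear implicits.

(* Extended-real valued, so that the distance to the empty set is [+oo]. *)
Definition dist_to (R : realType) n (x : 'rV[R]_n) (A : set 'rV[R]_n) : \bar R :=
  ereal_inf [set (enorm (y - x))%:E | y in A].

Definition is_proj (R : realType) n (C : set 'rV[R]_n) (x p : 'rV[R]_n) : Prop :=
  C p /\ forall q, C q -> enorm (x - p) <= enorm (x - q).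

Definition proj_set (R : realType) n (C A : set 'rV[R]_n) : set 'rV[R]_n :=
  [set p | exists2 a, A a & is_proj C a p].

Definition normal_cone (R : realType) n (C : set 'rV[R]_n) (x : 'rV[R]_n) :
    set 'rV[R]_n :=
  [set w | forall y, C y -> dot w (y - x) <= 0].

(* [C + e B] *)
Definition thicken (R : realType) n (C : set 'rV[R]_n) (e : R) : set 'rV[R]_n :=
  [set y | exists x u, [/\ C x, eball R n u & y = x + e *: u]].

Definition svmap_lipschitz (R : realType) n p (Phi : 'rV[R]_n -> set 'rV[R]_p)
    (L : R) (U : set 'rV[R]_n) : Prop :=
  forall x y, U x -> U y -> forall g, Phi x g ->
    exists g' b, [/\ Phi y g', eball R p b & g = g' + (L * enorm (x - y)) *: b].

Definition grad (R : realType) n (f : 'rV[R]_n -> R) (x : 'rV[R]_n) : 'rV[R]_n :=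
  \row_j 'D_(delta_mx 0 j) f x.

(* [f] is continuously differentiable on a neighbourhood of [x]. *)
Definition C1_at (R : realType) n (f : 'rV[R]_n -> R) (x : 'rV[R]_n) : Prop :=
  \forall y \near x, differentiable f y /\ {for y, continuous (grad f)}.

(* Clarke generalized directional derivative: the upper limit of
   [(f (y + t v) - f y) / t] as [y --> x] and [t --> 0+]. *)
Definition clarke_dd (R : realType) n (f : 'rV[R]_n -> R) (x v : 'rV[R]_n) :
    \bar R :=
  limf_esup (fun yt : 'rV[R]_n * R =>
      ((f (yt.1 + yt.2 *: v) - f yt.1) / yt.2)%:E)
    (filter_prod (nbhs x) (at_right (0 : R))).

Definition clarke (R : realType) n (f : 'rV[R]_n -> R) (x : 'rV[R]_n) :
    set 'rV[R]_n :=
  [set g | forall v, ((dot g v)%:E <= clarke_dd f x v)%E].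

(* Row vectors with their Borel sigma-algebra. *)
Definition borelV (R : realType) n : measurableType _ :=
  g_sigma_algebraType (@open 'rV[R]_n).

(* n-dimensional Lebesgue measure of a Borel set, as the iterated integral of
   the measures of its sections. *)
Fixpoint volume (R : realType) n : set 'rV[R]_n -> \bar R :=
  match n with
  | 0 => fun A => (\1_A (0 : 'rV[R]_0))%:E
  | m.+1 => fun A =>
      (\int[@lebesgue_measure R]_t
        @volume R m [set v : 'rV[R]_m | A (row_mx (const_mx t : 'rV[R]_1) v)])%E
  end.

Definition uniform_ball (R : realType) n (mu : set 'rV[R]_n -> \bar R) : Prop :=
  forall A : set (borelV R n), measurable A ->
    mu A = (((fine (volume (eball R n)))^-1)%:E * volume (A `&` eball R n))%E.

(* The part of the unit ball that is sent to [A] by the radial projection onto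
   the sphere of radius [r]. *)
Definition cone (R : realType) n (r : R) (A : set 'rV[R]_n) : set 'rV[R]_n :=
  [set y | [/\ y != 0, eball R n y & A ((r / enorm y) *: y)]].

(* The normalized surface measure of a subset of the sphere is the normalized
   volume of the cone that it spans in the unit ball. *)
Definition uniform_sphere (R : realType) n (r : R) (mu : set 'rV[R]_n -> \bar R) :
    Prop :=
  forall A : set (borelV R n), measurable A ->
    mu A = (((fine (volume (eball R n)))^-1)%:E * volume (cone r A))%E.

Definition mutually_independent d (Omega : measurableType d) (R : realType)
    (P : probability Omega R) (J : eqType) (D : set J)
    (E : J -> set (set Omega)) : Prop :=
  forall (s : seq J) (A : J -> set Omega), uniq s ->
    (forall j, j \in s -> D j /\ E j (A j)) ->
    fine (P (\big[setI/setT]_(j <- s) A j)) = \prod_(j <- s) fine (P (A j)).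

Definition events d (Omega : measurableType d) (R : realType)
    (P : probability Omega R) d' (T : measurableType d') (X : {RV P >-> T}) :
    set (set Omega) :=
  preimage_set_system setT X measurable.

(* [q] is the dimension of the random vector.  A profile is the concatenation
   of the strategies of the players, [submxrow x i] being that of player [i]. *)
Record game (R : realType) (N q : nat) := Game {
  sdim : 'I_N -> nat ;
  strat : forall i, set 'rV[R]_(sdim i) ;
  hs : forall i, 'rV[R]_(sdim i) -> 'rV[R]_q -> R ;
  ms : 'I_N -> 'rV[R]_(\sum_i sdim i) -> 'rV[R]_q -> R }.

Arguments strat {R N q} g i _.
Arguments hs {R N q} g i _ _.
Arguments ms {R N q} g i _ _.

Notation profile R G := ('rV[R]_(\sum_i sdim G i)).

(* The profile [(z, x_{-i})]. *)
Definition upd (R : realType) N q (G : game R N q) (x : profile R G) i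
    (z : 'rV[R]_(sdim G i)) : profile R G :=
  \mxrow_j eqtype.dfwith (fun k => submxrow x k) z j.
Arguments upd {R N q G} x i z.

Definition profiles (R : realType) N q (G : game R N q) : set (profile R G) :=
  [set x | forall i, strat G i (submxrow x i)].

Definition is_potential (R : realType) N q (G : game R N q)
    (f : 'I_N -> profile R G -> R) (Pot : profile R G -> R) : Prop :=
  forall i x z1 z2, profiles x -> strat G i z1 -> strat G i z2 ->
    Pot (upd x i z1) - Pot (upd x i z2) = f i (upd x i z1) - f i (upd x i z2).

Section Costs.
Context d (Omega : measurableType d) (R : realType) (P : probability Omega R).
Context (N q : nat) (G : game R N q) (xi : {RV P >-> borelV R q}).

Definition hcost i (z : 'rV[R]_(sdim G i)) : R :=
  fine ('E_P[fun w => hs G i z (xi w)])%E.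

Definition mcost i (x : profile R G) : R :=
  fine ('E_P[fun w => ms G i x (xi w)])%E.

Definition cost i (x : profile R G) : R := hcost (submxrow x i) + mcost i x.

Context (eta : R) (U : forall i, probability (borelV R (sdim G i)) R).

(* [U i] is meant to be the uniform law on the unit ball. *)
Definition hsmooth i (z : 'rV[R]_(sdim G i)) : R :=
  \int[U i]_(u in eball R (sdim G i)) hcost (z + eta *: u).

Definition scost i (x : profile R G) : R := hsmooth (submxrow x i) + mcost i x.

Definition clarke_nash (x : profile R G) : Prop :=
  profiles x /\ forall i, exists g w,
    [/\ clarke (fun z => scost i (upd x i z)) (submxrow x i) g,
        normal_cone (strat G i) (submxrow x i) w & g + w = 0].

Definition pgrad i (x : profile R G) : 'rV[R]_(sdim G i) :=
  grad (fun z => mcost i (upd x i z)) (submxrow x i).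

Definition spgrad i (x : profile R G) (s : 'rV[R]_q) : 'rV[R]_(sdim G i) :=
  grad (fun z => ms G i (upd x i z) s) (submxrow x i).

(* The set-valued maps [F] and [G_gamma]. *)
Definition Fmap (x : profile R G) : set (profile R G) :=
  [set g | forall i, exists2 s, clarke (@hcost i) (submxrow x i) s &
                                submxrow g i = s + pgrad i x].

Definition Gmap (gamma : R) (x : profile R G) : set (profile R G) :=
  [set gamma^-1 *: (x - p) |
    p in proj_set (@profiles R N q G) [set x - gamma *: g | g in Fmap x]].

Record lipschitz_game (L : 'I_N -> R) : Prop := LipschitzGame {
  strat_neq0 : forall i, strat G i !=set0 ;
  strat_closed : forall i, closed (strat G i) ;
  strat_convex : forall i,
    convex_set (strat G i : set (convex_lmodType 'rV[R]_(sdim G i))) ;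
  hs_measurable : forall i z, thicken (strat G i) eta z ->
    measurable_fun setT (hs G i z : borelV R q -> R) ;
  hs_integrable : forall i z, thicken (strat G i) eta z ->
    P.-integrable setT (fun w => (hs G i z (xi w))%:E) ;
  hs_lipschitz : forall i s z z',
    thicken (strat G i) eta z -> thicken (strat G i) eta z' ->
    `|hs G i z s - hs G i z' s| <= L i * enorm (z - z') ;
  ms_measurable : forall i x, profiles x ->
    \forall z \near submxrow x i,
      measurable_fun setT (ms G i (upd x i z) : borelV R q -> R) ;
  ms_integrable : forall i x, profiles x ->
    \forall z \near submxrow x i,
      P.-integrable setT (fun w => (ms G i (upd x i z) (xi w))%:E) ;
  ms_C1 : forall i x s, profiles x ->
    C1_at (fun z => ms G i (upd x i z) s) (submxrow x i) ;
  mcost_C1 : forall i x, profiles x ->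
    C1_at (fun z => mcost i (upd x i z)) (submxrow x i) ;
  has_potential : exists Pot, is_potential cost Pot }.

(* [Peta] is a continuously differentiable potential of the smoothed game,
   with [Leta]-Lipschitz gradient, attaining its extrema over the profiles. *)
Record smooth_potential (Peta : profile R G -> R) (Leta : R) : Prop :=
  SmoothPotential {
  Peta_potential : is_potential scost Peta ;
  Peta_C1 : forall x, profiles x -> C1_at Peta x ;
  Peta_lipschitz : forall x y, profiles x -> profiles y ->
    enorm (grad Peta x - grad Peta y) <= Leta * enorm (x - y) ;
  Peta_min : exists2 x, profiles x & forall y, profiles y -> Peta x <= Peta y ;
  Peta_max : exists2 x, profiles x & forall y, profiles y -> Peta y <= Peta x }.

Context (T : nat) (S : nat -> nat) (gamma : nat -> R) (PR : nat -> R).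
Context (Rk : {RV P >-> nat}).
Context (xis : nat -> 'I_N -> nat -> {RV P >-> borelV R q}).
Context (vs : nat -> forall i, nat -> {RV P >-> borelV R (sdim G i)}).
Context (x : nat -> Omega -> profile R G).

(* The random index (left), and the draws of [xi] and of the directions (right),
   which are labelled by iteration, player and sample. *)
Definition draw : eqType :=
  (unit + ((nat * 'I_N * nat) + (nat * 'I_N * nat)))%type.

Definition used_draw : set draw := [set j |
  match j with
  | inl _ => True
  | inr (inl (k, _, l)) | inr (inr (k, _, l)) => (k < T)%N /\ (l < S k)%N
  end].

Definition draw_events (j : draw) : set (set Omega) :=
  match j with
  | inl _ => events Rk
  | inr (inl (k, i, l)) => events (xis k i l)
  | inr (inr (k, i, l)) => events (vs k i l)
  end.

(* The sigma-algebra generated by the draws of the iterations before [k]. *)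
Definition history (k : nat) : set (set Omega) :=
  <<s [set A | exists k' i l, [/\ (k' < k)%N, (l < S k')%N &
                 events (xis k' i l) A \/ events (vs k' i l) A] ] >>.

Definition Delta_h k i l (w : Omega) : 'rV[R]_(sdim G i) :=
  let z := submxrow (x k w) i in
  let v : 'rV[R]_(sdim G i) := vs k i l w in
  let s := xis k i l w in
  ((sdim G i)%:R / (2 * eta) * (hs G i (z + v) s - hs G i (z - v) s) / enorm v)
    *: v.

Definition Delta_m k i l (w : Omega) : 'rV[R]_(sdim G i) :=
  spgrad i (x k w) (xis k i l w).

Record rs_rsg (x0 : profile R G) : Prop := RsRsg {
  gamma_gt0 : forall k, 0 < gamma k ;
  S_gt0 : forall k, (0 < S k)%N ;
  Rk_range : forall w, (1 <= Rk w <= T)%N ;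
  Rk_pmf : forall k, (1 <= k <= T)%N -> P (Rk @^-1` [set k]) = (PR k)%:E ;
  xis_law : forall k i l, (k < T)%N -> (l < S k)%N ->
    forall A, measurable A -> distribution P (xis k i l) A = distribution P xi A ;
  vs_law : forall k i l, (k < T)%N -> (l < S k)%N ->
    uniform_sphere eta (distribution P (vs k i l)) ;
  draws_independent : mutually_independent P used_draw draw_events ;
  x0_profile : profiles x0 ;
  x_init : forall w, x 0 w = x0 ;
  x_step : forall k w i, (k < T)%N ->
    is_proj (strat G i)
      (submxrow (x k w) i
       - gamma k *: ((S k)%:R^-1 *: \sum_(l < S k) (Delta_h k i l w
                                                   + Delta_m k i l w)))
      (submxrow (x k.+1 w) i) }.

(* Conditional unbiasedness and conditional variance bound given the past,
   tested on the events of the past. *)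
Record stochastic_gradient (sigma : R) : Prop := StochasticGradient {
  Delta_m_integrable : forall k i l j, (k < T)%N -> (l < S k)%N ->
    P.-integrable setT (fun w => (Delta_m k i l w 0 j)%:E) ;
  pgrad_integrable : forall k i j, (k < T)%N ->
    P.-integrable setT (fun w => (pgrad i (x k w) 0 j)%:E) ;
  Delta_m_unbiased : forall k i l j A, (k < T)%N -> (l < S k)%N -> history k A ->
    (\int[P]_(w in A) (Delta_m k i l w 0 j)%:E
     = \int[P]_(w in A) (pgrad i (x k w) 0 j)%:E)%E ;
  Delta_m_variance : forall k i l A, (k < T)%N -> (l < S k)%N -> history k A ->
    (\int[P]_(w in A) (enorm (Delta_m k i l w - pgrad i (x k w)) ^+ 2)%:E
     <= (sigma ^+ 2)%:E * P A)%E }.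

End Costs.

Arguments hcost {d Omega R P N q} G xi i z.

(* Main.v *)
(* Fix a player and write [h], [m] for the two parts of the cost and [C] for the
   strategy set.  By the Lipschitz property of the Clarke subdifferential, at the
   points [x + eta u] it is nonempty and included in that at [x] enlarged by
   [|Lhat| eta].  Points on the boundary of [C + eta B] have neighbours about
   which nothing is assumed; nevertheless a nonempty bounded Clarke
   subdifferential forces the generalized directional derivative of [h] to be
   finite in all directions (Hahn-Banach), hence [h] to be Lipschitz nearby, and
   to be the support function of the subdifferential.  By compactness of the ball
   the difference quotients of [h] at all the points [x + eta u] are uniformly
   bounded by [h'(x; v) + |Lhat| eta |v|] up to [e]; averaging over [u] gives the
   same bound for the smoothed function.  A further use of Hahn-Banach places
   any Clarke subgradient of the smoothed cost within [|Lhat| eta] of a Clarke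
   subgradient of [h] plus the gradient of [m].  At a Clarke-Nash equilibrium
   [x] is the projection of [x - gamma g], so nonexpansiveness of the projection
   yields the bound, with constant 1 instead of 2. *)

Require Import Defs.
From HB Require Import structures.
From mathcomp Require Import all_boot all_order all_algebra.
From mathcomp Require Import all_classical all_reals all_analysis.
From mathcomp Require Import measurable_realfun ring lra.

Set Implicit Arguments.
Unset Strict Implicit.
Unset Printing Implicit Defensive.

Import Order.TTheory GRing.Theory Num.Theory.
Import numFieldNormedType.Exports.

Local Open Scope classical_set_scope.
Local Open Scope ring_scope.

(** * Euclidean geometry of row vectors *)

Section Dot.
Context (R : realType) (n : nat).
Implicit Types (u v w : 'rV[R]_n) (a : R).

Lemma dotC u v : dot u v = dot v u.
Proof. by apply: eq_bigr => j _; rewrite mulrC. Qed.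

Lemma dotDl u v w : dot (u + v) w = dot u w + dot v w.
Proof. by rewrite -big_split; apply: eq_bigr => j _; rewrite mxE mulrDl. Qed.

Lemma dotZl a u v : dot (a *: u) v = a * dot u v.
Proof. by rewrite /dot mulr_sumr; apply: eq_bigr => j _; rewrite mxE mulrA. Qed.

Lemma dotNl u v : dot (- u) v = - dot u v.
Proof. by rewrite -scaleN1r dotZl mulN1r. Qed.

Lemma dotBl u v w : dot (u - v) w = dot u w - dot v w.
Proof. by rewrite dotDl dotNl. Qed.

Lemma dotDr u v w : dot w (u + v) = dot w u + dot w v.
Proof. by rewrite dotC dotDl !(dotC w). Qed.

Lemma dotZr a u v : dot u (a *: v) = a * dot u v.
Proof. by rewrite dotC dotZl dotC. Qed.

Lemma dotNr u v : dot u (- v) = - dot u v.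
Proof. by rewrite dotC dotNl dotC. Qed.

Lemma dotBr u v w : dot w (u - v) = dot w u - dot w v.
Proof. by rewrite dotDr dotNr. Qed.

Lemma dot0l u : dot 0 u = 0.
Proof. by rewrite -(scale0r 0) dotZl mul0r. Qed.

Lemma dot0r u : dot u 0 = 0.
Proof. by rewrite dotC dot0l. Qed.

Lemma dot_ge0 u : 0 <= dot u u.
Proof. by apply: sumr_ge0 => j _; rewrite -expr2 sqr_ge0. Qed.

Lemma enorm_ge0 u : 0 <= enorm u.
Proof. exact: sqrtr_ge0. Qed.

Lemma sqr_enorm u : enorm u ^+ 2 = dot u u.
Proof. by rewrite sqr_sqrtr // dot_ge0. Qed.

Lemma enorm_le a u : 0 <= a -> (enorm u <= a) = (dot u u <= a ^+ 2).
Proof.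
by move=> a0; rewrite -sqr_enorm ler_pXn2r // nnegrE enorm_ge0.
Qed.

Lemma enorm0 : enorm (0 : 'rV[R]_n) = 0.
Proof. by rewrite /enorm dot0l sqrtr0. Qed.

Lemma enormZ a u : enorm (a *: u) = `|a| * enorm u.
Proof.
by rewrite /enorm dotZl dotZr mulrA -expr2 sqrtrM ?sqr_ge0// sqrtr_sqr.
Qed.

Lemma enormN u : enorm (- u) = enorm u.
Proof. by rewrite -scaleN1r enormZ normrN1 mul1r. Qed.

Lemma enormB u v : enorm (u - v) = enorm (v - u).
Proof. by rewrite -opprB enormN. Qed.

(** Cauchy-Schwarz, from the nonnegative square of [dot v v *: u - dot u v *: v]; the degenerate
    case [dot v v = 0] forces [v = 0]. *)
Lemma dot_le_enorm u v : dot u v <= enorm u * enorm v.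
Proof.
apply: le_trans (ler_norm _) _.
rewrite -(@ler_pXn2r _ 2) ?nnegrE ?mulr_ge0 ?enorm_ge0//.
rewrite exprMn !sqr_enorm -normrX ger0_norm ?sqr_ge0//.
have [v0|v0] := eqVneq (dot v v) 0.
  have {}v0 : v = 0.
    apply/rowP => j; rewrite mxE; apply/eqP; rewrite -sqrf_eq0 eq_le sqr_ge0 andbT.
    rewrite -{}v0 /dot (bigD1 j)//= expr2 lerDl; apply: sumr_ge0 => i _.
    by rewrite -expr2 sqr_ge0.
  by rewrite v0 !dot0r mulr0 expr0n.
have vv : 0 < dot v v by rewrite lt_neqAle eq_sym v0 dot_ge0.
have := dot_ge0 (dot v v *: u - dot u v *: v).
rewrite !(dotBl, dotBr, dotZl, dotZr) (dotC v u) => h.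
suff : 0 <= dot v v * (dot u u * dot v v - dot u v ^+ 2).
  by rewrite pmulr_rge0 // subr_ge0.
by apply: le_trans h _; rewrite le_eqVlt; apply/orP; left; apply/eqP; ring.
Qed.

Lemma enormD u v : enorm (u + v) <= enorm u + enorm v.
Proof.
rewrite enorm_le ?addr_ge0 ?enorm_ge0// sqrrD !sqr_enorm !(dotDl, dotDr) (dotC v u).
have := dot_le_enorm u v; lra.
Qed.

Lemma coord_le_enorm u j : `|u 0 j| <= enorm u.
Proof.
rewrite -sqrtr_sqr ler_sqrt ?dot_ge0// /dot (bigD1 j)//= expr2 lerDl.
by apply: sumr_ge0 => i _; rewrite -expr2 sqr_ge0.
Qed.

Lemma norm_le_enorm u : `|u| <= enorm u.
Proof.
rewrite [leLHS]/Num.Def.normr/= mx_normrE.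
by apply: bigmax_le => [|[i j] _]; rewrite ?enorm_ge0// ord1 coord_le_enorm.
Qed.

Lemma coord_le_norm u j : `|u 0 j| <= `|u|.
Proof.
by rewrite [leRHS]/Num.Def.normr/= mx_normrE (le_bigmax _ _ (0, j)).
Qed.

(** Together with [norm_le_enorm] this links Euclidean estimates to neighbourhoods, which come from
    the sup norm; the crude constant [n] suffices. *)
Lemma enorm_le_norm u : enorm u <= n%:R * `|u|.
Proof.
rewrite enorm_le ?mulr_ge0//.
have -> : (n%:R * `|u|) ^+ 2 = \sum_(j < n) n%:R * `|u| ^+ 2.
  by rewrite sumr_const card_ord -mulr_natl exprMn expr2; ring.
apply: ler_sum => j _; have n1 : 1 <= n%:R :> R.
  by rewrite ler1n (leq_ltn_trans _ (ltn_ord j)).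
apply: (@le_trans _ _ (`|u| ^+ 2)); last by rewrite ler_peMl ?sqr_ge0.
rewrite -expr2 -(real_normK (num_real (u 0 j))).
by rewrite ler_pXn2r ?nnegrE// coord_le_norm.
Qed.

Lemma enorm_eq0 u : enorm u <= 0 -> u = 0.
Proof.
move=> u0; apply/eqP; rewrite -normr_eq0 eq_le normr_ge0 andbT.
exact: le_trans (norm_le_enorm u) u0.
Qed.

Lemma rowE_delta u : u = \sum_(j < n) u 0 j *: delta_mx 0 j.
Proof. by rewrite {1}[u]matrix_sum_delta big_ord1. Qed.

Lemma near_norm_le u (e : R) : 0 < e -> \forall v \near u, `|u - v| <= e.
Proof.
move=> e0; apply/nbhs_ballP; exists e => // v.
by rewrite mx_norm_ball /ball_ /= => /ltW.
Qed.

Lemma enorm_continuous : continuous (@enorm R n).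
Proof.
move=> u; apply/(@cvgrPdist_le _ _ _ (nbhs u) (nbhs_filter u)) => e e0.
have e1 : 0 < e / (n%:R + 1) by rewrite divr_gt0 // ltr_wpDl.
apply: filterS (near_norm_le u e1) => v uv.
have le1 : `|enorm u - enorm v| <= enorm (u - v).
  have := enormD (u - v) v; have := enormD (v - u) u.
  rewrite !subrK (enormB v u) => h1 h2.
  by rewrite ler_norml; apply/andP; split; lra.
apply: (le_trans le1); apply: (le_trans (enorm_le_norm _)).
move: uv; rewrite ler_pdivlMr ?ltr_wpDl// => h; apply: le_trans h.
by rewrite mulrC ler_wpM2l// lerDl.
Qed.

End Dot.

(** * Hahn-Banach for epigraphs and dense convex cones *)

Section HahnBanach.
Context (R : realType) (n : nat).
Local Notation V := 'rV[R]_n.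

(** Encodes a sublinear function [p] by upper bounds, [E v r] implying [p v <= r], so that no
    infimum has to be attained. [epicone_ge0] keeps [p] from being [-oo]. *)
Record epicone (E : V -> R -> Prop) : Prop := Epicone {
  epicone0 : E 0 0 ;
  epiconeD : forall v w r s, E v r -> E w s -> E (v + w) (r + s) ;
  epiconeZ : forall t v r, 0 < t -> E v r -> E (t *: v) (t * r) ;
  epicone_total : forall v, exists r, E v r ;
  epicone_ge0 : forall r, E 0 r -> 0 <= r }.

(** The new function is the infimum over [t >= 0] of [p (v + t u) - t a]; it stays nonnegative at 0
    because [a <= p u]. *)
Lemma epicone_step E u a : epicone E -> (forall r, E u r -> a <= r) ->
  exists E', [/\ epicone E', forall v r, E v r -> E' v r & E' (- u) (- a)].
Proof.
move=> cE ua.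
exists (fun v r => exists2 t, 0 <= t & E (v + t *: u) (r + t * a)); split.
- split.
  + by exists 0 => //; rewrite scale0r mul0r !addr0; exact: epicone0 cE.
  + move=> v w r s [t t0 vr] [t' t'0 ws]; exists (t + t'); first exact: addr_ge0.
    by rewrite scalerDl mulrDl !(addrACA _ _ (_ *: u)) (addrACA r); apply: epiconeD.
  + move=> c v r c0 [t t0 vr]; exists (c * t); first by rewrite mulr_ge0// ltW.
    by rewrite -scalerA -scalerDr -mulrA -mulrDr; apply: epiconeZ.
  + move=> v; have [r vr] := epicone_total cE v; exists r, 0 => //.
    by rewrite scale0r mul0r !addr0.
  + move=> r [t]; rewrite le_eqVlt => /predU1P[<-|t0].
      by rewrite scale0r mul0r !addr0; exact: epicone_ge0.
    rewrite add0r => /(epiconeZ cE (t := t^-1)).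
    rewrite invr_gt0 scalerA mulVf ?gt_eqF// scale1r => /(_ t0) /ua.
    rewrite mulrDr mulrA mulVf ?gt_eqF// mul1r lerDr.
    by rewrite pmulr_rge0 // invr_gt0.
- by move=> v r vr; exists 0 => //; rewrite scale0r mul0r !addr0.
- by exists 1 => //; rewrite scale1r mul1r !addNr; exact: epicone0 cE.
Qed.

(** With [a] the infimum of the bounds at [u], adjoining [- a] at [- u] makes [p] linear along [u];
    enlarging [E] preserves this for the vectors already treated. *)
Lemma epicone_linear_on (us : seq V) E : epicone E ->
  exists E', [/\ epicone E', forall v r, E v r -> E' v r &
    forall u, u \in us -> exists a, E' (- u) (- a) /\
      forall e, 0 < e -> exists2 r, r <= a + e & E' u r ].
Proof.
elim: us E => [|u us IH] E cE; first by exists E.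
have [E1 [cE1 EE1 lin1]] := IH E cE.
pose A := [set r | E1 u r].
have hA : has_inf A.
  split; first by have [r] := epicone_total cE1 u; exists r.
  have [s us'] := epicone_total cE1 (- u).
  exists (- s) => r /(epiconeD cE1 us'); rewrite addNr => /(epicone_ge0 cE1); lra.
have infA r : E1 u r -> inf A <= r by move=> ur; apply: ge_inf => //; case: hA.
have [E2 [cE2 E12 E2u]] := epicone_step cE1 infA.
exists E2; split => // [v r /EE1/E12//|v].
rewrite inE => /predU1P[->|vus].
  exists (inf A); split => // e e0.
  have [r ur re] := inf_adherent e0 hA.
  by exists r; [exact: ltW | exact: E12].
have [a [va va']] := lin1 v vus; exists a; split; first exact: E12.
by move=> e /va'[r ra vr]; exists r => //; exact: E12.
Qed.

Lemma epicone_sum E (J : finType) (F : J -> V) (r : J -> R) : epicone E ->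
  (forall j, E (F j) (r j)) -> E (\sum_j F j) (\sum_j r j).
Proof.
move=> cE EF; elim/big_ind2: _ => // [|v a w b];
  [exact: epicone0 cE | exact: epiconeD].
Qed.

(* Hahn-Banach for the sublinear function [v |-> inf [set r | E v r]]. *)
Theorem epicone_support E v0 a : epicone E -> (forall r, E v0 r -> a <= r) ->
  exists c, (forall v r, E v r -> dot c v <= r) /\ a <= dot c v0.
Proof.
move=> cE v0a.
(* Adjoining [- a] at [- v0] first forces [a <= dot c v0] for every linear [c] below the result. *)
have [E1 [cE1 EE1 E1v0]] := epicone_step cE v0a.
have [E2 [cE2 E12 lin]] :=
  epicone_linear_on [seq delta_mx 0 j | j <- enum 'I_n] cE1.
have /choice[f fP] : forall j : 'I_n, exists a, E2 (- delta_mx 0 j) (- a) /\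
      forall e, 0 < e -> exists2 r, r <= a + e & E2 (delta_mx 0 j) r.
  by move=> j; apply: lin; apply: map_f; rewrite mem_enum.
pose c : V := \row_j f j.
have key v r : E2 v r -> dot c v <= r.
  move=> vr; apply/ler_addgt0Pr => e e0.
  pose d := e / (\sum_j `|v 0 j| + 1).
  have S0 : 0 <= \sum_j `|v 0 j| by apply: sumr_ge0.
  have d0 : 0 < d by rewrite divr_gt0// ltr_wpDl.
  (* Upper bounds at the opposites of the components of [v]: exact when [v 0 j > 0], up to the slack
     [d] when [v 0 j < 0]. Added to [v] they sum to 0, where every bound is nonnegative. *)
  have H j : exists s, s <= - (v 0 j * f j) + d * `|v 0 j| /\
      E2 (- (v 0 j *: delta_mx 0 j)) s.
    have [fj fj'] := fP j.
    have [v0j|v0j|->] := ltgtP (v 0 j) 0.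
    - have [s sa Es] := fj' _ d0.
      exists (- v 0 j * s); rewrite -(scaleNr _ (delta_mx 0 j)); split; last first.
        by apply: (epiconeZ cE2) => //; rewrite oppr_gt0.
      rewrite (ltr0_norm v0j).
      have : - v 0 j * s <= - v 0 j * (f j + d) by rewrite ler_wpM2l// oppr_ge0 ltW.
      lra.
    - exists (v 0 j * - f j); rewrite -(scalerN _ (delta_mx 0 j)); split;
      last exact: (epiconeZ cE2).
      by rewrite gtr0_norm// mulrN lerDl mulr_ge0// ltW.
    - exists 0; rewrite scale0r oppr0 mul0r oppr0 normr0 mulr0 addr0; split => //.
      exact: epicone0 cE2.
  have /choice[s sP] := H.
  have := epicone_sum cE2 (fun j => (sP j).2).
  rewrite sumrN -rowE_delta => /(epiconeD cE2 vr);
    rewrite subrr => /(epicone_ge0 cE2).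
  have : \sum_j s j <= \sum_j (- (v 0 j * f j) + d * `|v 0 j|).
    by apply: ler_sum => j _; exact: (sP j).1.
  rewrite big_split/= sumrN -mulr_sumr.
  have -> : \sum_j v 0 j * f j = dot c v.
    by apply: eq_bigr => j _; rewrite mxE mulrC.
  have : d * (\sum_j `|v 0 j|) <= e.
    by rewrite /d mulrAC ler_pdivrMr ?ltr_wpDl// ler_wpM2l ?ltW// ltrDl.
  lra.
exists c; split => [v r /EE1/E12/key//|].
by have := key _ _ (E12 _ _ E1v0); rewrite dotNr lerN2.
Qed.

End HahnBanach.

Lemma enorm_sum (R : realType) n (I : Type) (r : seq I) (F : I -> 'rV[R]_n) :
  enorm (\sum_(i <- r) F i) <= \sum_(i <- r) enorm (F i).
Proof.
elim/big_ind2: _ => // [|u a v b ua vb]; first by rewrite enorm0.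
by apply: le_trans (enormD _ _) _; rewrite lerD.
Qed.

(** * Dense convex cones, and sublinear functions that may be infinite *)

Section Cones.
Context (R : realType) (n : nat).
Local Notation V := 'rV[R]_n.

Record cvxcone (D : set V) : Prop := Cvxcone {
  cvxcone0 : D 0 ;
  cvxconeD : forall v w, D v -> D w -> D (v + w) ;
  cvxconeZ : forall t v, 0 < t -> D v -> D (t *: v) }.

(** Cone vectors [u j] close to the canonical basis still form a basis, and a cone vector [d] close
    to [v - \sum_j u j] leaves a remainder with coordinates at least [-1]. Hence [v] is [d] plus a
    nonnegative combination of the [u j]. *)
Lemma dense_cvxcone (D : set V) : cvxcone D ->
  (forall (v : V) (e : R), 0 < e -> exists d, D d /\ enorm (v - d) <= e) ->
    D = setT.
Proof.
move=> cD densD; apply/seteqP; split => // v _.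
pose delta : R := 2^-1 / (n%:R + 1).
have n1 : 0 < n%:R + 1 :> R by rewrite ltr_wpDl.
have delta0 : 0 < delta by rewrite divr_gt0// invr_gt0.
have /choice[u uP] j := densD (delta_mx 0 j) delta delta0.
pose M : 'M[R]_n := \matrix_j u j.
have mulM (c : V) : c *m M = \sum_j c 0 j *: u j.
  by rewrite mulmx_sum_row; apply: eq_bigr => j _; rewrite rowK.
(* [M] moves [c] by at most half its norm, so it is injective with an inverse of norm at most 2;
   this offsets the distance [2^-1] chosen for [d] below. *)
have expM (c : V) : enorm c <= 2 * enorm (c *m M).
  have : enorm (c - c *m M) <= enorm c / 2.
    rewrite {1}[c]rowE_delta mulM -sumrB; apply: le_trans (enorm_sum _ _) _.
    apply: (@le_trans _ _ (\sum_(j < n) enorm c * delta)).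
      apply: ler_sum => j _; rewrite -scalerBr enormZ.
      by apply: ler_pM => //;
        [exact: enorm_ge0|exact: coord_le_enorm|exact: (uP j).2].
    rewrite sumr_const card_ord -(mulr_natr _ n) -mulrA; apply: ler_wpM2l;
      first exact: enorm_ge0.
    rewrite /delta mulrAC ler_pdivrMr// ler_wpM2l ?invr_ge0// lerDl.
    exact: ler01.
  have := enormD (c - c *m M) (c *m M); rewrite subrK; lra.
have unitM : M \in unitmx.
  rewrite -row_free_unit -kermx_eq0; apply/eqP/row_matrixP => i; rewrite row0.
  apply: enorm_eq0; apply: le_trans (expM _) _.
  by rewrite -row_mul mulmx_ker row0 enorm0 mulr0.
have half0 : 0 < 2^-1 :> R by rewrite invr_gt0.
have [d [Dd vd]] := densD (v - \sum_j u j) _ half0.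
pose c := (v - \sum_j u j - d) *m invmx M.
have c1 : enorm c <= 1.
  by apply: le_trans (expM _) _; rewrite mulmxKV//; lra.
have -> : v = d + \sum_j (1 + c 0 j) *: u j.
  under eq_bigr do rewrite scalerDl scale1r.
  by rewrite big_split/= -mulM mulmxKV// addrCA [d + _]addrC !subrK addrC subrK.
apply: (cvxconeD cD) => //; elim/big_ind: _ => [|x y|j _].
- exact: cvxcone0 cD.
- exact: cvxconeD cD _ _.
- have : 0 <= 1 + c 0 j.
    have := le_trans (coord_le_enorm c j) c1; rewrite ler_norml => /andP[]; lra.
  rewrite le_eqVlt => /predU1P[<-|c0]; first by rewrite scale0r; exact: cvxcone0 cD.
  by apply: (cvxconeZ cD c0); exact: (uP j).1.
Qed.

(* The bound on the supported functionals is what excludes the value [+oo]: a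
   functional that is nonpositive on the domain could be added to [g]. *)
Lemma cone_le_support (E : V -> R -> Prop) (K : V -> R) (g : V) : E 0 0 ->
  (forall v w r s, E v r -> E w s -> E (v + w) (r + s)) ->
  (forall t v r, 0 < t -> E v r -> E (t *: v) (t * r)) ->
  (forall v r s, E v r -> r <= s -> E v s) ->
  (forall v r, E v r -> dot g v <= r) ->
  (forall c, (forall v r, E v r -> dot c v <= r) -> forall v, dot c v <= K v) ->
  forall v e, 0 < e -> E v (K v + e).
Proof.
move=> E0 ED EZ EW gE CK.
pose D := [set v | exists r, E v r].
have cD : cvxcone D.
  split; first by exists 0.
  - by move=> v w [r vr] [s ws]; exists (r + s); exact: ED.
  - by move=> t v t0 [r vr]; exists (t * r); exact: EZ.
(* If a ball about [v] missed [D], Hahn-Banach for the distance to [D] would give [c] nonpositive on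
   [D] with [dot c v >= e]. *)
have DT : D = setT.
  apply: dense_cvxcone => // v e e0; apply: contrapT => /forallNP vD.
  pose F w r := exists2 d : V, D d & enorm (w - d) <= r.
  have cF : epicone F.
    split.
    - by exists 0; [exact: cvxcone0 cD|rewrite subr0 enorm0].
    - move=> w w' r r' [d Dd wd] [d' Dd' wd']; exists (d + d').
        exact: cvxconeD cD _ _ _ _.
      by rewrite opprD addrACA; apply: le_trans (enormD _ _) _; rewrite lerD.
    - move=> t w r t0 [d Dd wd]; exists (t *: d); first exact: cvxconeZ cD _ _ _ _.
      by rewrite -scalerBr enormZ gtr0_norm// ler_pM2l.
    - by move=> w; exists (enorm (w - 0)), 0 => //; exact: cvxcone0 cD.
    - by move=> r [d _]; apply: le_trans; exact: enorm_ge0.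
  have [|c [cF' cv]] := epicone_support (v0 := v) (a := e) cF.
    move=> r [d Dd vdr]; rewrite leNgt; apply/negP => re.
    by apply: (vD d); split => //; rewrite (le_trans vdr)// ltW.
  have cD0 d : D d -> dot c d <= 0.
    by move=> Dd; apply: cF'; exists d => //; rewrite subrr enorm0.
  (* Makes [l * e] exceed [K v - dot g v]: then [g + l *: c] is still below [E] but violates the
     bound by [K] at [v]. *)
  pose l := (`|K v| + `|dot g v| + 1) / e.
  have l0 : 0 <= l by rewrite divr_ge0 ?ltW// ltr_wpDl// addr_ge0.
  have : dot (g + l *: c) v <= K v.
    apply: CK => w r wr; rewrite dotDl dotZl.
    have /cD0 : D w by exists r.
    move=> /(ler_wpM2l l0); rewrite mulr0; have := gE _ _ wr; lra.
  rewrite dotDl dotZl; have := ler_wpM2l l0 cv.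
  rewrite /l divfK ?gt_eqF//; have := ler_norm (K v); have := ler_norm (- dot g v).
  rewrite normrN; lra.
move=> v e e0; apply: contrapT => nE.
have cE : epicone E.
  split => // [w|r /gE]; last by rewrite dot0r.
  by have : D w by rewrite DT.
have [|c [cE' cv]] := epicone_support (v0 := v) (a := K v + e) cE.
  by move=> r vr; rewrite leNgt; apply/negP => /ltW rK; apply: nE; exact: EW vr rK.
have := CK c cE' v; lra.
Qed.

End Cones.

(** * Clarke directional derivatives *)

Section Clarke.
Context (R : realType) (n : nat).
Local Notation V := 'rV[R]_n.
Implicit Types (f : V -> R) (x v w : V) (r s t : R).

Definition quot f v (yt : V * R) : R := (f (yt.1 + yt.2 *: v) - f yt.1) / yt.2.

Definition near_dd x : set_system (V * R) := filter_prod (nbhs x) (at_right 0).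

#[global] Instance near_dd_filter x : ProperFilter (near_dd x).
Proof. exact: filter_prod_proper. Qed.

(** Restricting to real bounds [r] turns the upper limit into an eventual inequality between reals,
    even if its value is infinite. *)
Lemma clarke_ddP f x v r : (clarke_dd f x v <= r%:E)%E <->
  forall e, 0 < e -> \forall yt \near near_dd x, quot f v yt <= r + e.
Proof.
split=> [dd e e0|dd].
  have : (clarke_dd f x v < (r + e)%:E)%E.
    by apply: le_lt_trans dd _; rewrite lte_fin ltrDl.
  rewrite /clarke_dd limf_esupE => /ereal_inf_lt[_ [A FA <-] Ar].
  apply: filterS FA => yt Ayt; rewrite -lee_fin; apply: ltW; apply: le_lt_trans Ar.
  by apply: ereal_sup_ubound; exists yt.
apply/lee_addgt0Pr => e e0; rewrite /clarke_dd limf_esupE.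
apply: ge_ereal_inf; exists (ereal_sup [set (quot f v yt)%:E | yt in
    [set yt | quot f v yt <= r + e]]);
      first by exists [set yt | quot f v yt <= r + e] => //; exact: dd.
by apply: ge_ereal_sup => _ [yt /= ? <-]; rewrite lee_fin.
Qed.

Lemma near_ddP x (P : set (V * R)) : near_dd x P <->
  exists2 d, 0 < d & forall y t, `|x - y| < d -> 0 < t -> t < d -> P (y, t).
Proof.
split=> [[[A B] /= [/nbhs_ballP[d d0 dA] [e e0 eB]] AB]|[d d0 dP]].
  exists (Num.min d e); first by rewrite lt_min d0 e0.
  move=> y t; rewrite !lt_min => /andP[xyd _] t0 /andP[_ te]; apply: AB;
    split => /=.
    by apply: dA; rewrite mx_norm_ball.
  by apply: eB => //=; rewrite -[Num.norm _]/(`|0 - t|) sub0r normrN gtr0_norm.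
exists (ball x d, [set t | 0 < t < d]) => /=.
  split; first exact: nbhsx_ballx.
  by exists d => //= t /=; rewrite sub0r normrN => td t0;
    rewrite t0 -(gtr0_norm t0).
by move=> [y t] /= [xy /andP[t0 td]]; apply: dP => //; move: xy;
  rewrite mx_norm_ball.
Qed.

Lemma clarke_dd0 f x : (clarke_dd f x 0 <= 0%:E)%E.
Proof.
apply/clarke_ddP => e e0; apply: nearW => yt.
by rewrite /quot scaler0 addr0 subrr mul0r add0r ltW.
Qed.

Lemma clarke_dd_ge0 f x r : (clarke_dd f x 0 <= r%:E)%E -> 0 <= r.
Proof.
move=> /clarke_ddP dd; apply/ler_addgt0Pr => e e0.
have [yt] := filter_ex (dd e e0).
by rewrite /quot scaler0 addr0 subrr mul0r.
Qed.

(** The point [y + t w] still tends to [x] as [t] tends to 0. This serves subadditivity and the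
    control of the end point of a difference quotient. *)
Lemma near_dd_shift x w (P : set (V * R)) : near_dd x P ->
  \forall yt \near near_dd x, P (yt.1 + yt.2 *: w, yt.2).
Proof.
move=> /near_ddP[d d0 dP]; apply/near_ddP.
pose c := d / (2 * (`|w| + 1)).
have w1 : 0 < `|w| + 1 by rewrite ltr_wpDl.
have c0 : 0 < c by rewrite divr_gt0// mulr_gt0.
have cd : c <= d / 2.
  rewrite ler_pdivrMr ?mulr_gt0// mulrA divfK ?pnatr_eq0// mulrDr mulr1 lerDr.
  by rewrite mulr_ge0// ltW.
have cw : c * `|w| <= d / 2.
  rewrite mulrAC ler_pdivrMr ?mulr_gt0// mulrA divfK ?pnatr_eq0//.
  by rewrite ler_wpM2l ?ltW// ltrDl.
exists c => // y t xy t0 tc /=; apply: dP => //; last by lra.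
rewrite opprD addrA; apply: le_lt_trans (ler_normB _ _) _.
rewrite normrZ (gtr0_norm t0).
have : t * `|w| <= c * `|w| by rewrite ler_wpM2r// ltW.
lra.
Qed.

Lemma near_dd_scale x c (P : set (V * R)) : 0 < c -> near_dd x P ->
  \forall yt \near near_dd x, P (yt.1, yt.2 * c).
Proof.
move=> c0 /near_ddP[d d0 dP]; apply/near_ddP; exists (Num.min d (d / c)).
  by rewrite lt_min d0 divr_gt0.
move=> y t; rewrite !lt_min => /andP[xy _] t0 /andP[_].
by rewrite ltr_pdivlMr// => tc; apply: dP => //; rewrite mulr_gt0.
Qed.

Lemma near_dd_gt0 x : \forall yt \near near_dd x, 0 < yt.2.
Proof. by apply/near_ddP; exists 1. Qed.

(** The quotient along [v + w] splits into one along [v] based at [y + t w] and one along [w] based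
    at [y]. *)
Lemma clarke_ddD f x v w r s : (clarke_dd f x v <= r%:E)%E ->
  (clarke_dd f x w <= s%:E)%E -> (clarke_dd f x (v + w) <= (r + s)%:E)%E.
Proof.
move=> /clarke_ddP vr /clarke_ddP ws; apply/clarke_ddP => e e0.
have e2 : 0 < e / 2 by rewrite divr_gt0.
apply: filterS2 (near_dd_shift w (vr _ e2)) (ws _ e2) => -[y t].
rewrite /quot/= => h1 h2.
rewrite (_ : _ / t = (f (y + t *: w + t *: v) - f (y + t *: w)) / t
   + (f (y + t *: w) - f y) / t); first by lra.
by rewrite -mulrDl subrKA scalerDr (addrC (t *: v)) addrA.
Qed.

Lemma clarke_ddZ f x c v r : 0 < c -> (clarke_dd f x v <= r%:E)%E ->
  (clarke_dd f x (c *: v) <= (c * r)%:E)%E.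
Proof.
move=> c0 /clarke_ddP vr; apply/clarke_ddP => e e0.
have e2 : 0 < e / c by rewrite divr_gt0.
apply: filterS2 (near_dd_gt0 x) (near_dd_scale c0 (vr _ e2)) => -[y t] /= t0.
rewrite /quot/= -scalerA invfM mulrA => h.
by move: h; rewrite ler_pdivrMr// [(r + _) * c]mulrDl divfK ?gt_eqF// (mulrC r).
Qed.

(** The form in which Hahn-Banach delivers functionals. The value [-oo] is excluded by testing with
    [dot g v - 1]. *)
Lemma clarkeP f x (g : V) : clarke f x g <->
  forall v r, (clarke_dd f x v <= r%:E)%E -> dot g v <= r.
Proof.
split=> [fg v r vr|fg v]; first by rewrite -lee_fin; exact: le_trans (fg v) vr.
case E : (clarke_dd f x v) => [r| |]; last 2 first.
- exact: leey.
- by have := fg v (dot g v - 1)%R; rewrite E leNye => /(_ isT);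
  rewrite lerDl oppr_ge0 ler10.
- by rewrite lee_fin; apply: fg; rewrite E.
Qed.

Lemma clarke_dd_lipschitz f x (L d : R) : 0 < d ->
  (forall y z, `|x - y| < d -> `|x - z| < d -> `|f y - f z| <= L * enorm (y - z)) ->
  forall v, (clarke_dd f x v <= (L * enorm v)%:E)%E.
Proof.
move=> d0 lip v; apply/clarke_ddP => e e0.
have nd : near_dd x [set yt | `|x - yt.1| < d] by apply/near_ddP; exists d.
apply: filterS3 (near_dd_gt0 x) nd (near_dd_shift v nd) => -[y t] /= t0 xy xz.
rewrite /quot ler_pdivrMr//=.
have := lip _ _ xz xy;
  rewrite [y + _ - y]addrAC subrr add0r enormZ (gtr0_norm t0) =>
    /(le_trans (ler_norm _)).
move=> h; apply: (le_trans h).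
rewrite mulrDl mulrCA (mulrC t) lerDl mulr_ge0// ltW//.
Qed.

(** Bounds in the directions of the basis vectors and their opposites control the increments along
    each coordinate; two nearby points are joined by changing one coordinate at a time. *)
Lemma clarke_dd_finite_lipschitz f x : (forall v, exists r,
  (clarke_dd f x v <= r%:E)%E) ->
  exists d L, 0 < d /\ forall y z, `|x - y| < d -> `|x - z| < d ->
    `|f y - f z| <= L * `|y - z|.
Proof.
move=> fin.
have [r rP] : exists r : 'I_n -> R, forall j,
    \forall yt \near near_dd x, quot f (delta_mx 0 j) yt <= r j /\
      quot f (- delta_mx 0 j) yt <= r j.
  suff /choice[r rP] : forall j, exists r, \forall yt \near near_dd x,
      quot f (delta_mx 0 j) yt <= r /\ quot f (- delta_mx 0 j) yt <= r.
    by exists r.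
  move=> j; have [a /clarke_ddP/(_ _ ltr01) ja] := fin (delta_mx 0 j).
  have [b /clarke_ddP/(_ _ ltr01) jb] := fin (- delta_mx 0 j).
  exists (Num.max (a + 1) (b + 1)).
  by apply: filterS2 ja jb => yt ha hb; rewrite !le_max ha hb orbT.
have /near_ddP[d d0 dP] := filter_forall (near_dd_filter x) rP.
pose K := \sum_j `|r j|.
have rK j : r j <= K.
  by rewrite /K (bigD1 j)//= (le_trans (ler_norm _))// lerDl sumr_ge0.
have step y (j : 'I_n) s : `|x - y| < d -> `|s| < d ->
    f (y + s *: delta_mx 0 j) - f y <= K * `|s|.
  move=> xy sd.
  have [s0|s0|->] := ltgtP s 0; last by rewrite scale0r addr0 subrr normr0 mulr0.
  - rewrite ltr0_norm// in sd *.
    have ns0 : 0 < - s by rewrite oppr_gt0.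
    have [_] := dP y (- s) xy ns0 sd j.
    rewrite /quot/= scaleNr scalerN opprK ler_pdivrMr ?oppr_gt0// => h.
    by apply: (le_trans h); rewrite ler_wpM2r// oppr_ge0 ltW.
  - rewrite gtr0_norm// in sd *.
    have [+ _] := dP y s xy s0 sd j.
    rewrite /quot/= ler_pdivrMr// => h.
    by apply: (le_trans h); rewrite ler_wpM2r// ltW.
have K0 : 0 <= K by apply: sumr_ge0.
have half y z : `|x - y| < d / 2 -> `|x - z| < d / 2 ->
  f z - f y <= n%:R * K * `|y - z|.
  move=> xy xz.
  (* In the sup norm this path from [y] to [z] is never farther from [x] than [y] and [z]; the
     radius [d / 2] keeps each of its steps shorter than [d]. *)
  pose w k : V := \row_j if (j < k)%N then z 0 j else y 0 j.
  have xw k : `|x - w k| < d.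
    rewrite [ltLHS]/Num.Def.normr/= mx_normrE.
    apply: bigmax_lt => // -[i j] _; rewrite ord1 /= !mxE.
    case: ifP => _.
      have := coord_le_norm (x - z) j; rewrite !mxE; lra.
    have := coord_le_norm (x - y) j; rewrite !mxE; lra.
  have fw k : (k <= n)%N -> f (w k) - f y <= k%:R * (K * `|y - z|).
    elim: k => [_|k IH kn].
      rewrite (_ : w 0%N = y) ?subrr ?mul0r//.
      by apply/rowP => j; rewrite !mxE.
    pose j := Ordinal kn.
    have -> : w k.+1 = w k + (z 0 j - y 0 j) *: delta_mx 0 j.
      apply/rowP => i; rewrite !mxE eqxx/= ltnS leq_eqVlt -[i == k :> nat]/(i == j).
      by have [->|ij] := eqVneq i j;
        rewrite ?ltnn/= ?mulr1 ?mulr0 ?addr0 // addrC subrK.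
    have zy : `|z 0 j - y 0 j| <= `|y - z|.
      by have := coord_le_norm (y - z) j; rewrite !mxE distrC.
    have yz : `|y - z| < d.
      by have := ler_distD x y z; rewrite (distrC y x); lra.
    have := step (w k) j _ (xw k) (le_lt_trans zy yz).
    have := ler_wpM2l K0 zy; have := IH (ltnW kn).
    by rewrite -natr1 mulrDl mul1r; lra.
  have := fw n (leqnn n); rewrite mulrA (_ : w n = z)//.
  by apply/rowP => j; rewrite !mxE ltn_ord.
exists (d / 2), (n%:R * K); split => [|y z xy xz]; first by rewrite divr_gt0.
rewrite ler_norml; apply/andP; split.
  by have := half y z xy xz; lra.
by have := half z y xz xy; rewrite distrC.
Qed.

Lemma clarke_dd_finite_continuous f x :
  (forall v, exists r, (clarke_dd f x v <= r%:E)%E) ->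
  \forall y \near x, {for y, continuous f}.
Proof.
move=> /clarke_dd_finite_lipschitz[d [L [d0 lip]]].
apply/nbhs_ballP; exists d => // y; rewrite mx_norm_ball /ball_ /= => xy.
apply/(@cvgrPdist_le _ _ _ (nbhs y) (nbhs_filter y)) => e e0.
have L1 : 0 < `|L| + 1 by rewrite ltr_wpDl.
have c0 : 0 < Num.min (d - `|x - y|) (e / (`|L| + 1)).
  by rewrite lt_min subr_gt0 xy divr_gt0.
apply/nbhs_ballP; exists (Num.min (d - `|x - y|) (e / (`|L| + 1))) => // z.
rewrite mx_norm_ball /ball_ /= lt_min (ltr_pdivlMr _ _ L1) => /andP[yz yze].
have xz : `|x - z| < d by have := ler_distD y x z; lra.
apply: le_trans (lip _ _ xy xz) _.
have : L * `|y - z| <= `|L| * `|y - z| by rewrite ler_wpM2r// ler_norm.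
by have := normr_ge0 (y - z); lra.
Qed.

(* A priori [clarke_dd f x v] may be [+oo] here. *)
Lemma clarke_dd_le_support f x (K : V -> R) : clarke f x !=set0 ->
  (forall g, clarke f x g -> forall v, dot g v <= K v) ->
  forall v, (clarke_dd f x v <= (K v)%:E)%E.
Proof.
move=> [g /clarkeP xg] gK v; apply/lee_addgt0Pr => e e0.
apply: (@cone_le_support _ _ (fun v r => (clarke_dd f x v <= r%:E)%E) K g) => //.
- exact: clarke_dd0.
- by move=> *; exact: clarke_ddD.
- by move=> *; exact: clarke_ddZ.
- by move=> w r s wr rs; apply: le_trans wr _; rewrite lee_fin.
- by move=> c cP; apply: gK; apply/clarkeP.
Qed.

Lemma clarke_epicone f x : (forall v, exists r, (clarke_dd f x v <= r%:E)%E) ->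
  epicone (fun v r => (clarke_dd f x v <= r%:E)%E).
Proof.
split => //; [exact: clarke_dd0| by move=> *; exact: clarke_ddD|
  by move=> *; exact: clarke_ddZ | exact: clarke_dd_ge0].
Qed.

Lemma clarke_nonempty f x : (forall v, exists r, (clarke_dd f x v <= r%:E)%E) ->
  clarke f x !=set0.
Proof.
move=> fin; have [|g [gP _]] := epicone_support (v0 := 0) (a := 0)
  (clarke_epicone fin).
  exact: clarke_dd_ge0.
by exists g; apply/clarkeP.
Qed.

(* Hahn-Banach for the infimal convolution of [clarke_dd f x] and [c |v|], the
   latter shifted by the linear form [g]. *)
Lemma clarke_dist f x (g : V) c : 0 <= c ->
  (forall v, exists r, (clarke_dd f x v <= r%:E)%E) ->
  (forall v r, (clarke_dd f x v <= r%:E)%E -> dot g v <= r + c * enorm v) ->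
  exists2 s, clarke f x s & enorm (g - s) <= c.
Proof.
move=> c0 fin gE; have cE := clarke_epicone fin.
pose E v r := exists w s, (clarke_dd f x w <= s%:E)%E /\
  s + c * enorm (v - w) + dot g (v - w) <= r.
have cE' : epicone E.
  split.
  - exists 0, 0; split; first exact: clarke_dd0.
    by rewrite subr0 enorm0 dot0r mulr0 !addr0.
  - move=> v v' r r' [w [s [ws h]]] [w' [s' [ws' h']]].
    exists (w + w'), (s + s'); split; first exact: clarke_ddD.
    rewrite opprD addrACA dotDr.
    have := ler_wpM2l c0 (enormD (v - w) (v' - w')); lra.
  - move=> t v r t0 [w [s [ws h]]]; exists (t *: w), (t * s); split.
      exact: clarke_ddZ.
    rewrite -scalerBr enormZ dotZr gtr0_norm//.
    by have := h; rewrite -(ler_pM2l t0); lra.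
  - by move=> v; have [r vr] := fin v; eexists; exists v, r; split;
    [exact: vr|exact: lexx].
  - move=> r [w [s [ws]]]; rewrite sub0r enormN dotNr; have := gE _ _ ws; lra.
have [|s [sE _]] := epicone_support (v0 := 0) (a := 0) cE';
  first exact: epicone_ge0 cE'.
exists s.
  apply/clarkeP => v r vr; apply: sE; exists v, r; split => //.
  by rewrite subrr enorm0 dot0r mulr0 !addr0.
(* Testing [s] in the direction [s - g], with [w = 0], gives [|s - g|^2 <= c |s - g|]. *)
have : dot s (s - g) <= c * enorm (s - g) + dot g (s - g).
  apply: sE; exists 0, 0; split; first exact: clarke_dd0.
  by rewrite subr0 add0r.
rewrite -lerBlDr -dotBl -sqr_enorm expr2 (enormB g).
have := enorm_ge0 (s - g); rewrite le_eqVlt => /predU1P[<-//|sg].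
by rewrite ler_pM2r.
Qed.

End Clarke.

(** * Smoothing and differentiable functions *)

Section Smoothing.
Context (R : realType) (n : nat).
Local Notation V := 'rV[R]_n.

Lemma closed_enorm_le (c : R) : closed [set u : V | enorm u <= c].
Proof.
apply: (@closed_comp _ _ (@enorm R n) [set r | r <= c]); last exact: closed_le.
by move=> u _; exact: enorm_continuous.
Qed.

Lemma compact_enorm_le (c : R) : compact [set u : V | enorm u <= c].
Proof.
apply: bounded_closed_compact; last exact: closed_enorm_le.
exists c; split => [|M cM u /= uc]; first exact: num_real.
by rewrite (le_trans (norm_le_enorm u))// (le_trans uc)// ltW.
Qed.

Lemma borelV_open (A : set V) : open A -> measurable (A : set (borelV R n)).
Proof. by move=> oA; exact: sub_sigma_algebra. Qed.

Lemma borelV_closed (A : set V) : closed A -> measurable (A : set (borelV R n)).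
Proof.
by move=> cA; rewrite -[A]setCK; apply: measurableC; apply: borelV_open;
  exact: closed_openC.
Qed.

Lemma measurable_eball : measurable (eball R n : set (borelV R n)).
Proof. by apply: borelV_closed; exact: closed_enorm_le. Qed.

(** Continuity is meant in the whole space, at points of [D] only: the preimage of an open ray then
    has the same trace on [D] as its interior. *)
Lemma continuous_at_measurable (D : set V) (f : V -> R) :
  measurable (D : set (borelV R n)) -> (forall u, D u -> {for u, continuous f}) ->
  measurable_fun (D : set (borelV R n)) (f : borelV R n -> R).
Proof.
move=> mD cf; apply: (measurability _ (RGenOInfty.measurableE R)) => //.
move=> _ [_ [a ->] <-].
pose O := interior (f @^-1` `]a, +oo[%classic).
rewrite (_ : _ `&` _ = D `&` O).
  by apply: measurableI => //; apply: borelV_open; exact: open_interior.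
apply/seteqP; split => [u [Du fu]|u [Du /interior_subset]]; last by split.
split => //; apply: cf => //.
by apply: open_nbhs_nbhs; split => //; exact: interval_open.
Qed.

Lemma continuous_at_integrable (mu : probability (borelV R n) R) (f : V -> R) :
  (forall u, eball R n u -> {for u, continuous f}) ->
  mu.-integrable (eball R n : set (borelV R n)) (EFin \o (f : borelV R n -> R)).
Proof.
move=> cf; apply: measurable_bounded_integrable.
- exact: measurable_eball.
- by apply: le_lt_trans (ltry 1); apply: probability_le1; exact: measurable_eball.
- exact: continuous_at_measurable measurable_eball cf.
suff : \forall M \near +oo, forall u, eball R n u -> `|f u| <= M.
  by [].
have /compact_near_coveringP := @compact_enorm_le 1.
move=> /(_ _ (+oo : set_system R) (fun M u => `|f u| <= M) _); apply => u u1.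
have nu : \forall u' \near u, `|f u - f u'| <= 1.
  exact: (iffLR (@cvgrPdist_le _ _ _ (nbhs u) (nbhs_filter u) f (f u)) (cf u u1)).
 exists ([set u' | `|f u - f u'| <= 1], [set M | `|f u| + 1 <= M]) => /=.
  by split => //; apply: nbhs_pinfty_ge; exact: num_real.
move=> [u' M] /= [uu' uM].
have := ler_distD (f u) 0 (f u'); rewrite !sub0r !normrN; lra.
Qed.

(** Being joint in [u'] and [z], this neighbourhood lets compactness pass from each [u] to the whole
    ball at once. *)
Lemma near_add_scale (Q : V -> Prop) (x u : V) (eta : R) :
  (\forall y \near (x + eta *: u), Q y) ->
  \forall u' \near u & z \near x, Q (z + eta *: u').
Proof.
move=> nQ; near_simpl.
have : (fun p : V * V => p.2 + eta *: p.1) @ (u, x) --> x + eta *: u.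
  apply: cvgD; first exact: cvg_snd.
  by apply: cvgZr; exact: cvg_fst.
by move=> /(_ _ nQ).
Qed.

Lemma near_dd_add_scale (P : set (V * R)) (x u : V) (eta : R) :
  near_dd (x + eta *: u) P ->
  \forall u' \near u & yt \near near_dd x, P (yt.1 + eta *: u', yt.2).
Proof.
move=> [[A B] /= [xA B0] AB].
have [[U X] /= [uU xX] UX] := near_add_scale xA.
exists (U, [set yt | X yt.1 /\ B yt.2]) => /=.
  split => //; exists (X, B) => //=.
by move=> [u' [y t]] /= [Uu' [Xy Bt]]; apply: AB; split => //; exact: (UX (u', y)).
Qed.

Lemma near_dd_fst x (Q : V -> Prop) : (\forall y \near x, Q y) ->
  \forall yt \near near_dd x, Q yt.1.
Proof. by move=> xQ; exists (Q, setT) => [|yt []//]; split => //;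
  exact: filterT. Qed.

(** Compactness makes the bound on the quotients uniform over the ball, and averaging preserves it
    since [mu] has mass 1 there. *)
Lemma clarke_dd_smoothing (h : V -> R) (mu : probability (borelV R n) R)
    (eta : R) (x v : V) (K : R) : mu (eball R n) = 1%E ->
  (forall u, eball R n u ->
    forall w, exists r, (clarke_dd h (x + eta *: u) w <= r%:E)%E) ->
  (forall u, eball R n u -> (clarke_dd h (x + eta *: u) v <= K%:E)%E) ->
  (clarke_dd (fun z => \int[mu]_(u in eball R n) h (z + eta *: u))%R x v <= K%:E)%E.
Proof.
move=> mu1 fin dd; apply/clarke_ddP => e e0.
have /compact_near_coveringP cpt := @compact_enorm_le 1.
(* Finite derivatives make [h] continuous at all the points [z + eta *: u], hence both integrands of
   the quotient integrable. *)
have near1 : \forall z \near x, forall u, eball R n u ->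
  {for z + eta *: u, continuous h}.
  apply: (cpt _ (nbhs x) (fun z u => {for z + eta *: u, continuous h})) => u u1.
  exact: (near_add_scale (clarke_dd_finite_continuous (fin u u1))).
have near2 : \forall yt \near near_dd x, forall u, eball R n u ->
    quot h v (yt.1 + eta *: u, yt.2) <= K + e.
  apply: (cpt _ (near_dd x) (fun yt u =>
    quot h v (yt.1 + eta *: u, yt.2) <= K + e)) => u u1.
  exact: (near_dd_add_scale (iffLR (clarke_ddP _ _ _ _) (dd u u1) e e0)).
have near3 := near_dd_fst near1.
apply: filterS2 (near_dd_gt0 x) (filterI near2 (filterI near3 (near_dd_shift v
  near3))).
move=> [y t] /= t0 [q [c0 c1]].
have int z : (forall u, eball R n u -> {for z + eta *: u, continuous h}) ->
    mu.-integrable (eball R n : set (borelV R n))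
      (EFin \o ((fun u => h (z + eta *: u)) : borelV R n -> R)).
  move=> cz; apply: continuous_at_integrable => u u1.
  have cu : {for u, continuous (fun u : V => z + eta *: u)}.
    apply: continuousD; first exact: cst_continuous.
    exact: scaler_continuous.
  exact: (@continuous_comp _ _ _ (fun u : V => z + eta *: u) h u cu (cz u u1)).
rewrite /quot/= ler_pdivrMr// -RintegralB//;
  [|exact: measurable_eball|exact: int|exact: int].
apply: (@le_trans _ _ (\int[mu]_(u in eball R n) ((K + e) * t))%R).
  apply: le_Rintegral.
  - exact: measurable_eball.
  - exact: (integrableB measurable_eball (int _ c1) (int _ c0)).
  - exact: (finite_measure_integrable_cst mu _ measurable_eball).
  - move=> u u1; have := q u u1; rewrite /quot/= ler_pdivrMr//.
    by rewrite [y + _ + _]addrAC.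
rewrite (Rintegral_cst mu measurable_eball) (_ : fine _ = 1) ?mulr1//.
exact: (congr1 fine mu1).
Qed.

Lemma clarke_dd_sum (f g : V -> R) x v r s : (clarke_dd f x v <= r%:E)%E ->
  (clarke_dd g x v <= s%:E)%E ->
    (clarke_dd (fun y => f y + g y)%R x v <= (r + s)%:E)%E.
Proof.
move=> /clarke_ddP fr /clarke_ddP gs; apply/clarke_ddP => e e0.
have e2 : 0 < e / 2 by rewrite divr_gt0.
apply: filterS2 (fr _ e2) (gs _ e2) => yt; rewrite /quot.
rewrite opprD addrACA mulrDl; lra.
Qed.

Lemma convex_comb_lt (l a b d : R) : 0 <= l -> l <= 1 -> a < d -> b < d ->
  (1 - l) * a + l * b < d.
Proof.
move=> l0 l1 ad bd; have [->|l00] := eqVneq l 0;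
  first by rewrite subr0 mul1r mul0r addr0.
have {}l0 : 0 < l by rewrite lt_neqAle eq_sym l00.
have : (1 - l) * a <= (1 - l) * d by rewrite ler_wpM2l ?subr_ge0// ltW.
have : l * b < l * d by rewrite ltr_pM2l.
lra.
Qed.

Lemma derive_grad (m : V -> R) y v : differentiable m y ->
  'D_v m y = dot (grad m y) v.
Proof.
move=> dm; rewrite deriveE// {1}[v]rowE_delta linear_sum.
apply: eq_bigr => j _; rewrite linearZ/= mxE deriveE// mulrC; congr (_ * _).
Qed.

(** By the mean value theorem the quotient is a directional derivative at a point between [y] and
    [y + t v], where the gradient is close to that at [x]. *)
Lemma C1_clarke_dd (m : V -> R) x v : C1_at m x ->
  (clarke_dd m x v <= (dot (grad m x) v)%:E)%E.
Proof.
move=> C1; apply/clarke_ddP => e e0.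
have [_ cx] := nbhs_singleton C1.
have near1 : \forall y \near x,
  differentiable m y /\ dot (grad m y) v <= dot (grad m x) v + e.
  have c0 : 0 < e / (enorm v + 1) by rewrite divr_gt0// ltr_wpDl// enorm_ge0.
  have : \forall y \near x, enorm (grad m y - grad m x) <= e / (enorm v + 1).
    have cE : {for x, continuous (fun y => enorm (grad m y - grad m x))}.
      have cB : {for x, continuous (fun y => grad m y - grad m x)}.
        by apply: continuousB cx _; exact: cst_continuous.
      exact: (@continuous_comp _ _ _ (fun y =>
        grad m y - grad m x) (@enorm R n) x cB
        (@enorm_continuous _ _ _)).
    have := iffLR (@cvgrPdist_le _ _ _ (nbhs x) (nbhs_filter x) _ _) cE _ c0.
    rewrite (subrr (grad m x)) enorm0.
    by apply: filterS => y; rewrite sub0r normrN ger0_norm ?enorm_ge0.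
  apply: filterS2 C1 => y [dm _] h; split => //.
  rewrite -lerBlDl -dotBl; apply: le_trans (dot_le_enorm _ _) _.
  move: h; rewrite ler_pdivlMr ?ltr_wpDl ?enorm_ge0//.
  by apply: le_trans; rewrite ler_wpM2l ?enorm_ge0// lerDl.
have /nbhs_ballP[d d0 dP] := near1.
have nd : near_dd x [set yt | `|x - yt.1| < d] by apply/near_ddP; exists d.
apply: filterS3 (near_dd_gt0 x) nd (near_dd_shift v nd) => -[y t] /= t0 xy xz.
rewrite /quot/= ler_pdivrMr//.
have seg s : s \in `[0, t] -> `|x - (y + s *: v)| < d.
  rewrite in_itv/= => /andP[s0 st].
  have l0 : 0 <= s / t by rewrite divr_ge0// ltW.
  have l1 : s / t <= 1 by rewrite ler_pdivrMr// mul1r.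
  have -> : x - (y + s *: v) = (1 - s / t) *: (x - y) + (s / t) *: (x - (y + t *:
    v)).
    rewrite !opprD !addrA (scalerBr (s / t) (x - y)) scalerA divfK ?gt_eqF//.
    by rewrite scalerBl scale1r addrA subrK.
  apply: le_lt_trans (ler_normD _ _) _;
    rewrite (normrZ (1 - s / t)) (normrZ (s / t)) (ger0_norm l0).
  by rewrite ger0_norm ?subr_ge0//; apply: convex_comb_lt.
pose phi (s : R) := m (y + s *: v).
have der s : s \in `[0, t] -> is_derive s 1 phi ('D_v m (y + s *: v)).
  move=> st; have [|dm _] := dP (y + s *: v); first by rewrite mx_norm_ball;
    exact: seg.
  have E : (fun h : R => h^-1 *: (phi (h *: 1 + s) - phi s)) =
           (fun h : R => h^-1 *: (m (h *: v + (y + s *: v)) - m (y + s *: v))).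
    by apply/funext => h; rewrite /phi [h *: 1]mulr1 scalerDl addrCA.
  split; first by rewrite /derivable E; exact: diff_derivable.
  by rewrite /derive E.
have derO c : c \in `]0, t[ -> is_derive c 1 phi ('D_v m (y + c *: v)).
  by move=> ct; apply: der; apply: subset_itv_oo_cc ct.
have cphi : {within `[0, t], continuous phi}.
  by apply: derivable_within_continuous => c ct; have [] := der c ct.
have [c ct] := @MVT_segment R phi (fun c =>
  'D_v m (y + c *: v)) 0 t (ltW t0) derO cphi.
rewrite /phi scale0r addr0 subr0 => ->; rewrite ler_pM2r//.
have [|dm] := dP (y + c *: v); first by rewrite mx_norm_ball; exact: seg.
by rewrite derive_grad.
Qed.

End Smoothing.

(** * Projections *)

Section Projection.
Local Open Scope convex_scope.
Context (R : realType) (n : nat).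
Local Notation V := 'rV[R]_n.

Lemma convex_segment (C : set V) : convex_set (C : set (convex_lmodType V)) ->
  forall p q t, C p -> C q -> 0 < t -> t <= 1 -> C (p + t *: (q - p)).
Proof.
move=> cC p q t Cp Cq t0 t1.
have tI : Itv.spec (@Itv.num_sem R) (Itv.Real `[0%Z, 1%Z]) t.
  by rewrite /= /Itv.num_sem/= num_real/= in_itv/= t1 ltW.
have := cC q p (Itv.mk tI); rewrite !inE => /(_ Cq Cp).
suff -> : (q : convex_lmodType V) <| Itv.mk tI |> p = p + t *: (q - p) :> V by [].
rewrite /conv/= /unstable.onem scalerBl scale1r scalerBr.
by rewrite addrCA addrA.
Qed.

(** Comparing [p] with [p + t (q - p)] and expanding squares gives [2 D <= t N], which fails for
    small [t] if [D > 0]. *)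
Lemma proj_variational (C : set V) a p :
  convex_set (C : set (convex_lmodType V)) -> is_proj C a p ->
  forall q, C q -> dot (a - p) (q - p) <= 0.
Proof.
move=> cC [Cp pP] q Cq; rewrite leNgt; apply/negP => D0.
pose D := dot (a - p) (q - p); pose N := dot (q - p) (q - p).
have N0 : 0 <= N := dot_ge0 _.
have key t : 0 < t -> t <= 1 -> 2 * D <= t * N.
  move=> t0 t1; have := pP _ (convex_segment cC Cp Cq t0 t1).
  rewrite enorm_le ?enorm_ge0// sqr_enorm opprD addrA /D /N.
  move: (a - p) (q - p) => u w;
    rewrite !(dotBl, dotBr, dotZl, dotZr) (dotC w u) => h.
  have : 0 <= t * (t * dot w w - 2 * dot u w) by lra.
  by rewrite pmulr_rge0// subr_ge0.
(* This [t] satisfies [t N <= D]; the denominator [N + 1] also covers [N = 0]. *)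
have := key (Num.min 1 (D / (N + 1))).
have N1 : 0 < N + 1 by rewrite ltr_wpDl.
rewrite lt_min ltr01 divr_gt0// ge_min lexx => /(_ isT isT).
apply/negP; rewrite -ltNge.
apply: (@le_lt_trans _ _ D); last by rewrite -[ltLHS]mul1r ltr_pM2r// ltr1n.
apply: (@le_trans _ _ (D / (N + 1) * N)).
  by rewrite ler_wpM2r// ge_min lexx orbT.
by rewrite mulrAC ler_pdivrMr// ler_wpM2l ?ltW// ltrDl.
Qed.

(** The distance is minimised over a compact truncation of [C] that keeps [c0]; each discarded point
    is farther from [a] than [c0]. *)
Lemma proj_exists (C : set V) a : C !=set0 -> closed C -> exists p, is_proj C a p.
Proof.
move=> [c0 Cc0] clC.
pose A := C `&` [set u | enorm u <= enorm a + enorm (a - c0)].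
have A0 : A !=set0.
  exists c0; split => //=; have := enormD a (c0 - a).
  by rewrite addrC subrK (enormB c0).
have cA : compact A.
  by rewrite /A setIC; apply: compact_closedI clC; exact: compact_enorm_le.
have cf : continuous (fun u : V => enorm (a - u)).
  move=> u; apply: (@continuous_comp _ _ _ (fun u : V => a - u) (@enorm R n)).
    by apply: continuousB; [exact: cst_continuous|].
  exact: enorm_continuous.
have [p] := EVT_min_rV A0 cA (continuous_subspaceT cf).
rewrite inE => -[Cp _] pP; exists p; split => // q Cq.
have [qA|qA] := leP (enorm q) (enorm a + enorm (a - c0)).
  by apply: pP; rewrite inE.
have := pP c0; rewrite inE => /(_ _)/le_trans; apply.
  split => //=; have := enormD a (c0 - a).
  by rewrite addrC subrK (enormB c0).
have := enormD a (q - a); rewrite addrC subrK (enormB q); lra.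
Qed.

(* The optimality condition says that [x] is the projection of [x - t g]. *)
Lemma proj_grad_le (C : set V) (x p g f w : V) (t : R) : 0 < t ->
  convex_set (C : set (convex_lmodType V)) -> C x -> normal_cone C x w ->
    g + w = 0 ->
  is_proj C (x - t *: f) p -> enorm (x - p) <= t * enorm (g - f).
Proof.
move=> t0 cC Cx wN gw pP.
have h2 : dot g (x - p) <= 0.
  have -> : g = - w by apply/eqP; rewrite -addr_eq0 gw.
  by rewrite dotNl -dotNr opprB; apply: wN; case: pP.
(* The variational inequality for [p], tested at [x], and the optimality of [x], tested at [p],
   combine before Cauchy-Schwarz. *)
have : enorm (x - p) ^+ 2 <= t * enorm (g - f) * enorm (x - p).
  rewrite sqr_enorm; apply: (@le_trans _ _ (t * dot (f - g) (x - p))).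
    move: (proj_variational cC pP Cx) h2;
      rewrite [x - _ - p]addrAC (dotBl (x - p)) dotZl (dotBl f).
    by move=> h /(ler_wpM2l (ltW t0)); rewrite mulr0; lra.
  by rewrite -mulrA ler_pM2l// (enormB g) dot_le_enorm.
have := enorm_ge0 (x - p); rewrite le_eqVlt => /predU1P[<- _|e0].
  by rewrite mulr_ge0 ?enorm_ge0// ltW.
by rewrite expr2 ler_pM2r.
Qed.

Lemma thicken_near (C : set V) eta x y : 0 < eta -> C x -> enorm (y - x) <= eta ->
  thicken C eta y.
Proof.
move=> eta0 Cx xy; exists x, (eta^-1 *: (y - x)); split => //.
  by rewrite /eball/= enormZ gtr0_norm ?invr_gt0// mulrC ler_pdivrMr// mul1r.
by rewrite scalerA divff ?gt_eqF// scale1r addrC subrK.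
Qed.

Lemma smoothed_clarke_dist (h m : V -> R) (C : set V)
    (mu : probability (borelV R n) R) (eta L Lhat : R) (x g : V) :
  0 < eta -> mu (eball R n) = 1%E -> C x ->
  (forall y z, thicken C eta y -> thicken C eta z ->
    `|h y - h z| <= L * enorm (y - z)) ->
  svmap_lipschitz (clarke h) Lhat (thicken C eta) ->
  C1_at m x ->
  clarke (fun z => \int[mu]_(u in eball R n) h (z + eta *: u) + m z) x g ->
  exists2 s, clarke h x s & enorm (g - (s + grad m x)) <= `|Lhat| * eta.
Proof.
move=> eta0 mu1 Cx lip svl C1 /clarkeP gP.
have Tx : thicken C eta x by apply: thicken_near Cx _ => //;
  rewrite subrr enorm0 ltW.
have n1 : 0 < n%:R + 1 :> R by rewrite ltr_wpDl.
(* A full neighbourhood of [x] lies in [thicken C eta] even if [x] is on the boundary of [C], so [h]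
   is Lipschitz about [x]. *)
have near y : `|x - y| < eta / (n%:R + 1) -> thicken C eta y.
  move=> xy; apply: thicken_near Cx _ => //; rewrite enormB.
  apply: le_trans (enorm_le_norm _) _.
  apply: (@le_trans _ _ ((n%:R + 1) * `|x - y|));
    first by rewrite ler_wpM2r// lerDl.
  by rewrite mulrC -ler_pdivlMr// ltW.
have fin v : exists r, (clarke_dd h x v <= r%:E)%E.
  exists (L * enorm v); apply: (@clarke_dd_lipschitz _ _ _ _ _ (eta / (n%:R + 1))).
    by rewrite divr_gt0.
  by move=> y z xy xz; apply: lip; exact: near.
have [g0 xg0] := clarke_nonempty fin.
have [p pE] : exists p : V -> R, forall v, clarke_dd h x v = (p v)%:E.
  exists (fun v => fine (clarke_dd h x v)) => v; rewrite fineK// fin_numE.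
  have [r vr] := fin v; have := xg0 v.
  by case: (clarke_dd h x v) vr.
pose K v := p v + `|Lhat| * eta * enorm v.
(* The inclusion from [x] to [x + eta *: u] gives nonemptiness, the reverse one the bound by [K].
   The absolute value appears because the sign of [Lhat] is free. *)
have dK u : eball R n u -> forall v, (clarke_dd h (x + eta *: u)%R v <= (K v)%:E)%E.
  move=> u1; have Ty : thicken C eta (x + eta *: u)%R by exists x, u.
  apply: clarke_dd_le_support.
    by have [g' [b [yg' _ _]]] := svl _ _ Tx Ty _ xg0; exists g'.
  move=> c yc v; have [g' [b [/clarkeP xg' b1 ->]]] := svl _ _ Ty Tx _ yc.
  rewrite dotDl dotZl; apply: lerD; first by apply: xg'; rewrite pE.
  rewrite addrC addKr enormZ (gtr0_norm eta0).
  have -> : Lhat * (eta * enorm u) * dot b v = Lhat * eta * (enorm u * dot b v)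
    by ring.
  apply: le_trans (ler_norm _) _; rewrite !normrM (gtr0_norm eta0).
  rewrite ler_wpM2l ?mulr_ge0// ?(ltW eta0)// (ger0_norm (enorm_ge0 u))
    -[leRHS]mul1r.
  apply: ler_pM => //; first exact: enorm_ge0.
  have bv : enorm b * enorm v <= enorm v by rewrite ler_piMl// enorm_ge0.
  rewrite ler_norml; apply/andP; split; last exact: le_trans (dot_le_enorm _ _) bv.
  by rewrite lerNl -dotNl; apply: le_trans (dot_le_enorm _ _) _; rewrite enormN.
have [||s xs gs] := @clarke_dist _ _ h x (g - grad m x) (`|Lhat| * eta) _ fin.
- by rewrite mulr_ge0// ltW.
- move=> v r; rewrite pE lee_fin => pr.
  have : dot g v <= K v + dot (grad m x) v.
    apply: gP; apply: clarke_dd_sum (C1_clarke_dd _ C1).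
    apply: clarke_dd_smoothing => // [u u1 w|u u1]; last exact: dK.
    by exists (K w); exact: dK.
  by rewrite dotBl /K; lra.
exists s => //; by rewrite opprD addrA addrAC.
Qed.

End Projection.

(** * The game *)

Section Integrals.
Import HBNNSimple.
Context d (T : measurableType d) (R : realType) (P : probability T R).

(* The integral of a nonnegative function, measurable or not, is the supremum of
   the integrals of the simple functions below it. *)
Lemma integral_le_ae_bound (f : T -> \bar R) (c : R) : (forall w, (0 <= f w)%E) ->
  {ae P, forall w, (f w <= c%:E)%E} -> 0 <= c -> (\int[P]_w f w <= c%:E)%E.
Proof.
move=> f0 fc c0; rewrite ge0_integralTE//.
apply: ge_ereal_sup => _ [h hf <-].
rewrite -(integralT_nnsfun P h).
have <- : (\int[P]_w (cst c%:E w) = c%:E)%E.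
  by rewrite integral_cst//= probability_setT mule1.
apply: ae_ge0_le_integral => //=.
- by move=> w _; rewrite lee_fin; exact: fun_ge0.
- exact/measurable_EFinP.
- by apply: filterS fc => w fw _; apply: le_trans (hf w) fw.
Qed.

Lemma expectation_dist_le (f g : T -> R) (c : R) :
  P.-integrable setT (EFin \o f) -> P.-integrable setT (EFin \o g) ->
  (forall w, `|f w - g w| <= c) ->
  `|fine 'E_P[f]%E - fine 'E_P[g]%E| <= c.
Proof.
move=> intf intg fg; rewrite unlock.
rewrite -[X in `|X|]/(\int[P]_(w in setT) f w - \int[P]_(w in setT) g w)%R.
have int : P.-integrable setT (EFin \o (fun w =>
  f w - g w)) := integrableB measurableT intf intg.
rewrite -RintegralB//; apply: le_trans (le_normr_Rintegral _ int) _ => //.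
apply: (@le_trans _ _ (\int[P]_(w in setT) c)%R); last first.
  by rewrite Rintegral_cst//= probability_setT mulr1.
apply: le_Rintegral => //; first exact: integrable_norm.
exact: finite_measure_integrable_cst.
Qed.

End Integrals.

(** The defining formula takes the same value on the ball and on the whole space, whose mass is
    1. *)
Lemma uniform_ball_eball (R : realType) n (mu : probability (borelV R n) R) :
  uniform_ball mu -> mu (eball R n) = 1%E.
Proof.
move=> muU; rewrite -(@probability_setT _ _ _ mu).
by rewrite (muU _ (@measurable_eball R n)) (muU _ measurableT) setIid setTI.
Qed.

Lemma submxrowZ (R : realType) N (p : 'I_N ->
  nat) (c : R) (u : 'rV[R]_(\sum_i p i)) i :
  submxrow (c *: u) i = c *: submxrow u i.
Proof. by apply/rowP => j; rewrite !mxE. Qed.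

Lemma dot_submxrow (R : realType) N (p : 'I_N -> nat) (u v : 'rV[R]_(\sum_i p i)) :
  dot u v = \sum_i dot (submxrow u i) (submxrow v i).
Proof.
have dotE n (a b : 'rV[R]_n) : dot a b = (a *m b^T) 0 0.
  by rewrite mxE; apply: eq_bigr => j _; rewrite mxE.
rewrite dotE -[u in LHS]submxrowK -[v in LHS]submxrowK tr_mxrow mul_mxrow_mxcol
  summxE.
by apply: eq_bigr => i _; rewrite dotE.
Qed.

(** * Blockwise assembly over the players *)

Section Game.
Context d (Omega : measurableType d) (R : realType) (P : probability Omega R).
Context (N q : nat) (G : game R N q) (xi : {RV P >-> borelV R q}) (eta : R).

Lemma hcost_lipschitz L i : lipschitz_game G xi eta L ->
  forall y z, thicken (strat G i) eta y -> thicken (strat G i) eta z ->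
  `|hcost G xi i y - hcost G xi i z| <= L i * enorm (y - z).
Proof.
move=> lg y z Ty Tz; apply: expectation_dist_le.
- exact: (hs_integrable lg Ty).
- exact: (hs_integrable lg Tz).
- by move=> w; exact: (hs_lipschitz lg).
Qed.

(** Squared Euclidean distances between profiles are sums over the players, so minimising each block
    minimises the whole. *)
Lemma is_proj_profiles (a p : profile R G) :
  (forall i, is_proj (strat G i) (submxrow a i) (submxrow p i)) ->
  is_proj (@profiles R N q G) a p.
Proof.
move=> ap; split => [i|r rG]; first exact: (ap i).1.
rewrite enorm_le ?enorm_ge0// sqr_enorm !dot_submxrow; apply: ler_sum => i _.
rewrite -!sqr_enorm ler_pXn2r ?nnegrE ?enorm_ge0// !submxrowB.
exact: (ap i).2.
Qed.

(** The distance being an infimum, one element of [Gmap] suffices: take for each player a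
    subgradient of [hcost] close to the equilibrium one, then project blockwise. *)
Lemma dist_Gmap_le (U : forall i,
  probability (borelV R (sdim G i)) R) (L Lhat : 'I_N -> R)
    (gamma : R) (x : profile R G) :
  0 < eta -> 0 < gamma -> lipschitz_game G xi eta L ->
    (forall i, uniform_ball (U i)) ->
  (forall i, svmap_lipschitz (clarke (hcost G xi i)) (Lhat i)
               (thicken (strat G i) eta)) ->
  clarke_nash xi eta U x ->
  (dist_to 0%R (Gmap xi gamma x) ^+ 2 <= (eta ^+ 2 * \sum_(i < N) Lhat i ^+
    2)%:E)%E.
Proof.
move=> eta0 gamma0 lg uU svl [xG nash].
have loc i : exists fp : 'rV[R]_(sdim G i) * 'rV[R]_(sdim G i),
   [/\ clarke (hcost G xi i) (submxrow x i) fp.1,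
       is_proj (strat G i) (submxrow x i - gamma *: (fp.1 + pgrad xi i x)) fp.2 &
       enorm (submxrow x i - fp.2) <= gamma * (`|Lhat i| * eta)].
  have [g [w [xg wN gw]]] := nash i.
  have scostE : (fun z => scost xi eta U i (upd x i z)) =
      (fun z => \int[U i]_(u in eball R (sdim G i)) hcost G xi i (z + eta *: u)
                + mcost xi i (upd x i z)).
    by apply/funext => z; rewrite /scost /hsmooth /upd mxrowK dfwith_in.
  rewrite scostE in xg.
  have [s xs gs] := smoothed_clarke_dist eta0 (uniform_ball_eball (uU i)) (xG i)
    (hcost_lipschitz lg) (svl i) (mcost_C1 lg i xG) xg.
  have [p pP] := proj_exists (submxrow x i - gamma *: (s + pgrad xi i x))
    (strat_neq0 lg i) (strat_closed lg (i := i)).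
  exists (s, p); split => //=.
  apply: le_trans (proj_grad_le gamma0 (strat_convex lg (i := i)) (xG i) wN gw
    pP) _.
  by rewrite ler_pM2l.
pose s i := sval (cid (loc i)).
have sP i : [/\ clarke (hcost G xi i) (submxrow x i) (s i).1,
    is_proj (strat G i) (submxrow x i - gamma *: ((s i).1 + pgrad xi i x)) (s i).2 &
    enorm (submxrow x i - (s i).2) <= gamma * (`|Lhat i| * eta)] := svalP (cid
      (loc i)).
pose g : profile R G := \mxrow_i ((s i).1 + pgrad xi i x).
pose p : profile R G := \mxrow_i (s i).2.
have Gp : Gmap xi gamma x (gamma^-1 *: (x - p)).
  exists p => //; exists (x - gamma *: g).
    exists g => // i; exists (s i).1; first by case: (sP i).
    by rewrite mxrowK.
  by apply: is_proj_profiles => i; rewrite submxrowB submxrowZ !mxrowK;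
    case: (sP i).
have bound : enorm (gamma^-1 *: (x - p)) ^+ 2 <= eta ^+ 2 * \sum_(i < N) Lhat i
  ^+ 2.
  (* Each block of [x - p] is bounded by a multiple of [gamma], which cancels the factor
     [gamma^-1]. *)
  rewrite enormZ exprMn sqr_enorm dot_submxrow gtr0_norm ?invr_gt0// exprVn.
  rewrite mulrC ler_pdivrMr ?exprn_gt0// mulr_sumr mulr_suml; apply: ler_sum => i _.
  rewrite -sqr_enorm submxrowB mxrowK.
  have -> : eta ^+ 2 * Lhat i ^+ 2 * gamma ^+ 2 = (gamma * (`|Lhat i| * eta)) ^+ 2.
    by rewrite !exprMn real_normK ?num_real//; ring.
  by rewrite ler_pXn2r ?nnegrE ?enorm_ge0 ?mulr_ge0 ?(ltW eta0) ?(ltW gamma0)//;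
    case: (sP i).
have le1 : (dist_to 0%R (Gmap xi gamma x) <= (enorm (gamma^-1 *: (x - p)))%:E)%E.
  by apply: ereal_inf_lbound; exists (gamma^-1 *: (x - p)) => //; rewrite subr0.
have ge0 : (0 <= dist_to 0%R (Gmap xi gamma x))%E.
  by apply: le_ereal_inf_tmp => _ [y _ <-]; rewrite lee_fin enorm_ge0.
apply: (@le_trans _ _ ((enorm (gamma^-1 *: (x - p)) ^+ 2)%:E));
  last by rewrite lee_fin.
by rewrite EFin_expe !expe2 lee_pmul.
Qed.

End Game.
Theorem corollary4p1 (d : measure_display) (Omega : measurableType d)
  (R : realType) (P : probability Omega R) (N q : nat) (G : game R N q)
  (* random vector, smoothing parameter, uniform laws on the unit balls *)
  (xi : {RV P >-> borelV R q}) (eta : R)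
  (U : forall i, probability (borelV R (sdim G i)) R)
  (L Lhat : 'I_N -> R) (Peta : profile R G -> R) (Leta sigma : R)
  (* horizon, batch sizes, stepsizes, law of the random index *)
  (T : nat) (S : nat -> nat) (gamma : nat -> R) (PR : nat -> R)
  (* random index, draws, iterates *)
  (Rk : {RV P >-> nat})
  (xis : nat -> 'I_N -> nat -> {RV P >-> borelV R q})
  (vs : nat -> forall i, nat -> {RV P >-> borelV R (sdim G i)})
  (x0 : profile R G) (x : nat -> Omega -> profile R G) :
  0 < eta ->
  lipschitz_game G xi eta L ->
  (forall i, uniform_ball (U i)) ->
  smooth_potential xi eta U Peta Leta ->
  rs_rsg xi eta T S gamma PR Rk xis vs x x0 ->
  stochastic_gradient xi T S xis vs x sigma ->
  (forall i, svmap_lipschitz (clarke (hcost G xi i)) (Lhat i)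
               (thicken (strat G i) eta)) ->
  {ae P, forall w, clarke_nash xi eta U (x (Rk w) w)} ->
  (\int[P]_w (dist_to 0%R (Gmap xi (gamma (Rk w)) (x (Rk w) w)) ^+ 2)
   <= (2 * eta ^+ 2 * \sum_(i < N) Lhat i ^+ 2)%:E)%E.
Proof.
move=> eta0 lg uU _ rs _ svl nash.
have S0 : 0 <= \sum_(i < N) Lhat i ^+ 2 by apply: sumr_ge0 => i _; exact: sqr_ge0.
apply: integral_le_ae_bound => [w||]; last by rewrite mulr_ge0// mulr_ge0 ?sqr_ge0.
  by apply: expe_ge0; apply: le_ereal_inf_tmp => _ [y _ <-];
    rewrite lee_fin enorm_ge0.
(* With the outcome fixed, the bound depends neither on the index [Rk w] nor on the stepsize; its
   constant 1 is then relaxed to 2. *)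
apply: filterS nash => w nw.
apply: le_trans (dist_Gmap_le eta0 (gamma_gt0 rs (Rk w)) lg uU svl nw) _.
by rewrite lee_fin -mulrA ler_peMl ?ler1n// mulr_ge0 ?sqr_ge0.
Qed.
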